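(* Let $r$ be a positive rational number such that $\alpha=\sqrt{r}$ is irrational. Then for every $\varepsilon>0$ there is a constant $C=C(\alpha,\varepsilon)>0$ such that $\delta_{\min}^{(\alpha)}(N)\le C\,N^{-1+\varepsilon}$ for all integers $N\ge 2$.
   Context: For irrational $\alpha>0$, the numbers $\alpha m^2+n^2$ with integers $m,n\ge 1$ (the Dirichlet eigenvalues of the Laplacian on a rectangle of width $\pi/\sqrt{\alpha}$ and height $\pi$) are pairwise distinct; list them in increasing order as $0<\lambda_1<\lambda_2<\cdots$. For $N\ge 2$ define the minimal gap $\delta_{\min}^{(\alpha)}(N)=\min\{\lambda_{i+1}-\lambda_i : 1\le i<N\}$. *)

(* Defs.v *)
From Stdlib Require Import Reals Lra Lia QArith List ClassicalEpsilon.
Open Scope R_scope.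

(* x is a Dirichlet eigenvalue of the rectangle: x = alpha m^2 + n^2, m,n >= 1 *)
Definition eigval (alpha x : R) : Prop :=
  exists m n : nat, (1 <= m)%nat /\ (1 <= n)%nat /\
    x = alpha * INR m ^ 2 + INR n ^ 2.

(* x is the k-th eigenvalue (1-indexed) in increasing order:
   x is an eigenvalue and exactly k-1 eigenvalues are strictly smaller. *)
Definition is_kth_eigval (alpha : R) (k : nat) (x : R) : Prop :=
  eigval alpha x /\
  exists l : list R, NoDup l /\ length l = (k - 1)%nat /\
    forall y, In y l <-> (eigval alpha y /\ y < x).

Definition lam (alpha : R) (k : nat) : R :=
  epsilon (inhabits 0) (is_kth_eigval alpha k).

Definition delta_min (alpha : R) (N : nat) : R :=
  fold_right Rmin (lam alpha 2 - lam alpha 1)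
    (map (fun i => lam alpha (S i) - lam alpha i) (seq 1 (N - 1))).

(* Main.v *)
(* Write alpha = sqrt D / q with D a nonsquare positive integer, and let w > 1 be
   a unit x + y sqrt D of norm 1, with powers w^n = X_n + Y_n sqrt D, so that
   X_n - sqrt D Y_n = w^(-n).  If q Y_n = a b and X_n = c d with a, b, c, d all of
   size about w^(n/2), then alpha (2a+b)^2 + (2c-d)^2 and alpha (2a-b)^2 + (2c+d)^2
   are eigenvalues of size about w^n at distance 8 w^(-n).

   Balanced factorizations come from the identity
   gcd (f a) (f b) = f (gcd a b) for odd a, b, valid for both f = X and f = Y.  Take
   n = F_0 ... F_(k-1) l with F_i = 2^(2^i) + 1 the Fermat numbers and l odd.  The
   lcm of the f (n / F_i) divides f n and, by inclusion-exclusion, has size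
   w^(n (1 - prod (1 - 1/F_i))) up to a constant, and prod (1 - 1/F_i) tends to
   1/2.  As l ranges over the odd numbers, n has bounded gaps. *)
Require Import Defs.
From Stdlib Require Import Reals QArith ZArith Lra Lia List FinFun.
From Stdlib Require Import Classical ClassicalEpsilon IndefiniteDescription.
Open Scope R_scope.

(** * A solution of Pell's equation *)

Lemma pigeonhole {A : Type} (g : nat -> A) (l : list A) (k : nat) :
  (length l < k)%nat -> (forall i, (i < k)%nat -> In (g i) l) ->
  exists i j, (i < j < k)%nat /\ g i = g j.
Proof.
  intros Hl Hin. apply NNPP. intro Hno.
  assert (Hnd : NoDup (map g (seq 0 k))).
  { apply Injective_map_NoDup_in; [|apply seq_NoDup].
    intros i j Hi Hj Hij. apply in_seq in Hi, Hj.
    destruct (Nat.lt_total i j) as [H|[H|H]]; [|exact H|];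
      exfalso; apply Hno; [exists i, j|exists j, i]; split; auto; lia. }
  apply NoDup_incl_length with (l' := l) in Hnd.
  - rewrite length_map, length_seq in Hnd. lia.
  - intros y Hy. apply in_map_iff in Hy. destruct Hy as [i [<- Hi]].
    apply in_seq in Hi. apply Hin. lia.
Qed.

(** Dirichlet's pigeonhole argument: the [Q + 1] fractional parts of [i * s] with [i <= Q] fall into
    [Q] intervals of length [1 / Q], and two in the same interval differ by less than [1 / Q]. *)
Lemma dirichlet_approximation (s : R) (Q : nat) :
  (1 <= Q)%nat ->
  exists a b : Z, (1 <= b <= Z.of_nat Q)%Z /\ Rabs (IZR a - IZR b * s) < / INR Q.
Proof.
  intros HQ.
  assert (HQ0 : 0 < INR Q) by (apply lt_0_INR; lia).
  pose (t := fun i : nat => INR Q * frac_part (INR i * s)).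
  assert (Ht : forall i, 0 <= t i < INR Q).
  { intro i. unfold t. destruct (base_fp (INR i * s)). split; nra. }
  pose (g := fun i => Int_part (t i)).
  assert (Hg : forall i, IZR (g i) <= t i < IZR (g i) + 1).
  { intro i. unfold g. destruct (base_Int_part (t i)). lra. }
  destruct (pigeonhole g (map Z.of_nat (seq 0 Q)) (S Q)) as [i [j [Hij E]]].
  - rewrite length_map, length_seq. lia.
  - intros i _. specialize (Ht i). specialize (Hg i).
    assert (H1 : (-1 < g i)%Z) by (apply lt_IZR; lra).
    assert (H2 : (g i < Z.of_nat Q)%Z)
      by (apply lt_IZR; rewrite <- INR_IZR_INZ; lra).
    apply in_map_iff. exists (Z.to_nat (g i)). split; [lia|].
    apply in_seq. lia.
  - exists (Int_part (INR j * s) - Int_part (INR i * s))%Z, (Z.of_nat j - Z.of_nat i)%Z.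
    split; [lia|].
    rewrite !minus_IZR, <- !INR_IZR_INZ.
    pose proof (Hg i) as Hi. pose proof (Hg j) as Hj. rewrite E in Hi.
    unfold t in Hi, Hj. unfold frac_part in Hi, Hj.
    set (u := INR j * s) in *. set (v := INR i * s) in *.
    apply Rmult_lt_reg_l with (INR Q); [exact HQ0|].
    rewrite Rinv_r by lra. rewrite <- (Rabs_right (INR Q)) at 1 by lra.
    rewrite <- Rabs_mult. replace ((INR j - INR i) * s) with (u - v) by (unfold u, v; ring).
    apply Rabs_def1; nra.
Qed.

Section Pell.

Variable D : Z.
Hypothesis D_pos : (0 < D)%Z.
Hypothesis D_nonsquare : forall a b : Z, b <> 0%Z -> (a * a <> D * b * b)%Z.

Let s := sqrt (IZR D).
Let err (p : Z * Z) := Rabs (IZR (fst p) - IZR (snd p) * s).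
(** The Dirichlet quality |a/b - s| < 1/b^2, with the denominators cleared. *)
Let good (p : Z * Z) := (1 <= snd p)%Z /\ err p * IZR (snd p) < 1.
Let norm (p : Z * Z) := (fst p * fst p - D * snd p * snd p)%Z.

Local Lemma s_sqr : s * s = IZR D.
Proof. apply sqrt_sqrt. apply IZR_le. lia. Qed.

Local Lemma s_pos : 0 < s.
Proof. apply sqrt_lt_R0. apply IZR_lt. lia. Qed.

Local Lemma err_pos p : good p -> 0 < err p.
Proof.
  intros [Hb _]. apply Rabs_pos_lt. intro E.
  apply (D_nonsquare (fst p) (snd p)); [lia|].
  apply eq_IZR. rewrite !mult_IZR, <- s_sqr.
  replace (IZR (fst p)) with (IZR (snd p) * s) by lra. ring.
Qed.

Local Lemma good_small (th : R) : 0 < th -> exists p, good p /\ err p < th.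
Proof.
  intros Hth.
  destruct (archimed_cor1 th Hth) as [Q [HQ HQ0]].
  destruct (dirichlet_approximation s Q) as [a [b [Hb H]]]; [lia|].
  exists (a, b). unfold good, err; cbn [fst snd].
  assert (HQ1 : 0 < INR Q) by (apply lt_0_INR; lia).
  assert (Hb1 : 1 <= IZR b) by (apply IZR_le; lia).
  assert (Hb2 : IZR b <= INR Q) by (rewrite INR_IZR_INZ; apply IZR_le; lia).
  repeat split; [lia| |lra].
  apply Rlt_le_trans with (/ INR Q * IZR b).
  - apply Rmult_lt_compat_r; lra.
  - apply Rmult_le_reg_l with (INR Q); [lra|].
    rewrite <- Rmult_assoc, Rinv_r by lra. lra.
Qed.

(** With e = a - b s the norm is e (e + 2 b s). Since |e| < 1 and |e| b < 1, it is at most 1 + 2 s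
    in absolute value, and s <= D. Hence only finitely many norms occur. *)
Local Lemma good_norm p : good p -> (Z.abs (norm p) <= 2 * D + 1)%Z.
Proof.
  intros Hg. pose proof (err_pos p Hg) as He. destruct Hg as [Hb H].
  pose proof s_sqr as Hs. pose proof s_pos as Hs0.
  apply le_IZR. rewrite abs_IZR, plus_IZR, mult_IZR. unfold norm.
  rewrite minus_IZR, !mult_IZR, <- Hs.
  destruct p as [a b]; unfold err in *; cbn [fst snd] in *.
  assert (Hb1 : 1 <= IZR b) by (apply IZR_le; lia).
  assert (HD : 1 <= IZR D) by (apply IZR_le; lia).
  assert (HsD : s <= IZR D) by nra.
  replace (IZR a * IZR a - s * s * IZR b * IZR b)
    with ((IZR a - IZR b * s) * ((IZR a - IZR b * s) + 2 * (IZR b * s))) by ring.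
  rewrite Rabs_mult.
  set (e := IZR a - IZR b * s) in *.
  assert (Ht : Rabs (e + 2 * (IZR b * s)) <= Rabs e + 2 * (IZR b * s)).
  { eapply Rle_trans; [apply Rabs_triang|].
    rewrite (Rabs_right (2 * (IZR b * s))); [lra|nra]. }
  assert (Rabs e < 1) by nra.
  rewrite Hs.
  assert (Rabs e * Rabs (e + 2 * (IZR b * s)) <= Rabs e * (Rabs e + 2 * (IZR b * s)))
    by (apply Rmult_le_compat_l; lra).
  assert (Rabs e * IZR b * s <= 1 * s) by (apply Rmult_le_compat_r; lra).
  nra.
Qed.

(* Two approximations of equal norm [n], congruent modulo [n], have a quotient
   in Z[sqrt D], which is then a unit of norm 1. *)
Lemma pell_solution : exists x y : Z, y <> 0%Z /\ (x * x = D * y * y + 1)%Z.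
Proof.
  destruct (functional_choice (fun (th : R) p => 0 < th -> good p /\ err p < th))
    as [f Hf].
  { intro th. destruct (Rlt_dec 0 th) as [H|H].
    - destruct (good_small th H) as [p Hp]. exists p. auto.
    - exists (0%Z, 0%Z). intro; contradiction. }
  (* Each term beats the error of its predecessor, which is positive by irrationality; so all terms
     are distinct. *)
  pose (u := fix u (k : nat) := match k with O => f 1 | S k => f (err (u k)) end).
  assert (Hg : forall k, good (u k)).
  { induction k as [|k IH]; cbn.
    - apply Hf. lra.
    - apply Hf. apply err_pos, IH. }
  assert (Hdec : forall i j, (i < j)%nat -> err (u j) < err (u i)).
  { intros i j Hij. induction Hij as [|j _ IH]; cbn.
    - apply Hf. apply err_pos, Hg.
    - eapply Rlt_trans; [|exact IH]. apply Hf. apply err_pos, Hg. }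
  assert (Hn0 : forall k, norm (u k) <> 0%Z).
  { intros k E. destruct (Hg k) as [Hb _].
    apply (D_nonsquare (fst (u k)) (snd (u k))); unfold norm in E; lia. }
  set (B := (2 * D + 1)%Z).
  set (rng := map (fun k => Z.of_nat k - B)%Z (seq 0 (Z.to_nat (2 * B + 1)))).
  assert (Hrng : forall z, (Z.abs z <= B)%Z -> In z rng).
  { intros z Hz. apply in_map_iff. exists (Z.to_nat (z + B)).
    split; [lia|]. apply in_seq. lia. }
  (* The norms are nonzero and bounded by [B], and so are residues modulo them: there are finitely
     many classes for infinitely many approximations. *)
  pose (cls := (fun k => ((norm (u k), fst (u k) mod norm (u k)),
                         snd (u k) mod norm (u k)))%Z).
  destruct (pigeonhole cls (list_prod (list_prod rng rng) rng)
              (S (length (list_prod (list_prod rng rng) rng)))) as [i [j [Hij E]]].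
  - lia.
  - intros k _. pose proof (good_norm _ (Hg k)) as HB. fold B in HB.
    pose proof (Hn0 k) as H0.
    assert (Hmod : forall z, (Z.abs (z mod norm (u k)) <= B)%Z).
    { intro z.
      destruct (Z.lt_ge_cases 0 (norm (u k))).
      - pose proof (Z.mod_pos_bound z (norm (u k))). lia.
      - pose proof (Z.mod_neg_bound z (norm (u k))). lia. }
    repeat apply in_prod; apply Hrng; auto.
  - injection E as En Ea Eb. rewrite <- En in Ea, Eb.
    pose proof (Hn0 i) as H0. pose proof (Hdec i j (proj1 Hij)) as Herr.
    destruct (Hg i) as [Hbi _]. destruct (Hg j) as [Hbj _].
    pose proof (Z.div_mod (fst (u i)) (norm (u i)) H0) as Mi.
    pose proof (Z.div_mod (fst (u j)) (norm (u i)) H0) as Mj.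
    pose proof (Z.div_mod (snd (u i)) (norm (u i)) H0) as Ni.
    pose proof (Z.div_mod (snd (u j)) (norm (u i)) H0) as Nj.
    rewrite <- Ea in Mj. rewrite <- Eb in Nj.
    unfold norm at 1 in En. unfold norm at 1 in En.
    assert (Hni : norm (u i) = (fst (u i) * fst (u i) - D * snd (u i) * snd (u i))%Z)
      by reflexivity.
    assert (Hne : u i <> u j) by (intro Eu; rewrite Eu in Herr; lra).
    revert H0 Mi Mj Ni Nj En Hni Hbi Hbj Hne. clear.
    destruct (u i) as [a b], (u j) as [a' b']; cbn [fst snd].
    generalize (norm (a, b)) as n. intros n.
    generalize (a / n)%Z (a' / n)%Z (a mod n)%Z (b / n)%Z (b' / n)%Z (b mod n)%Z.
    intros qa qa' ra qb qb' rb H0 Mi Mj Ni Nj En Hni Hbi Hbj Hne.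
    assert (Ea' : (a' = a + n * (qa' - qa))%Z) by lia.
    assert (Eb' : (b' = b + n * (qb' - qb))%Z) by lia.
    set (s1 := (qa' - qa)%Z) in *. set (s2 := (qb' - qb)%Z) in *.
    (* These are the coordinates of (a + b sqrt D) (a' - b' sqrt D) / n, the quotient of the two
       approximations; substituting a' = a + n s1 and b' = b + n s2 cancels n. *)
    exists (1 + a * s1 - D * b * s2)%Z, (s1 * b - a * s2)%Z.
    assert (Hx : (n * (1 + a * s1 - D * b * s2) = a * a' - D * b * b')%Z)
      by (rewrite Ea', Eb'; rewrite Hni at 1; rewrite Hni; ring).
    assert (Hy : (n * (s1 * b - a * s2) = a' * b - a * b')%Z)
      by (rewrite Ea', Eb'; ring).
    split.
    (* A vanishing second coordinate makes the pairs proportional; equal norms and positive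
       denominators then make them equal. *)
    + intro Ey. rewrite Ey in Hy.
      assert (Hab : (a' * b = a * b')%Z) by lia.
      assert (Hb2 : (b * b * n = b' * b' * n)%Z).
      { rewrite Hni at 2.
        transitivity ((a' * b) * (a' * b) - D * b * b * b' * b')%Z.
        - rewrite Hni, En. ring.
        - rewrite Hab. ring. }
      assert (b = b').
      { apply Z.mul_reg_r in Hb2; [|exact H0].
        assert (E : ((b - b') * (b + b') = 0)%Z) by lia.
        apply Z.mul_eq_0 in E. lia. }
      apply Hne. f_equal; [|assumption]. subst b'.
      symmetry. apply Z.mul_reg_r with b; lia.
    (* Brahmagupta's identity: norms multiply, so both factors of norm n give a product of norm
       n^2. *)
    + apply Z.mul_reg_l with (n * n)%Z; [apply Z.neq_mul_0; split; exact H0|].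
      transitivity ((n * (1 + a * s1 - D * b * s2)) * (n * (1 + a * s1 - D * b * s2)))%Z; [ring|].
      transitivity (D * (n * (s1 * b - a * s2)) * (n * (s1 * b - a * s2)) + n * n)%Z; [|ring].
      rewrite Hx, Hy.
      transitivity (D * (a' * b - a * b') * (a' * b - a * b')
         + (a * a - D * b * b) * (a' * a' - D * b' * b'))%Z; [ring|].
      rewrite <- En, <- Hni. ring.
Qed.

End Pell.

(** * Balanced factorizations in divisibility sequences *)

(** Write a = a' g and d = d' g with g = gcd a d. As lcm a b divides a' lcm g b, cancelling g shows
    that d' divides a' (lcm g b / g), and d' is coprime to a'. *)
Lemma divide_lcm_gcd_l (a b d : nat) :
  Nat.divide d (Nat.lcm a b) -> Nat.divide d (Nat.lcm (Nat.gcd a d) b).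
Proof.
  intros H. destruct (Nat.eq_dec (Nat.gcd a d) 0) as [Hg|Hg].
  { apply Nat.gcd_eq_0 in Hg. destruct Hg as [-> ->]. exact H. }
  set (g := Nat.gcd a d) in *.
  destruct (Nat.gcd_divide_l a d) as [a' Ha]. destruct (Nat.gcd_divide_r a d) as [d' Hd].
  fold g in Ha, Hd.
  assert (Hcop : Nat.gcd d' a' = 1%nat).
  { apply Nat.mul_cancel_r with g; [exact Hg|].
    rewrite <- Nat.gcd_mul_mono_r, <- Ha, <- Hd, Nat.gcd_comm. fold g. lia. }
  assert (Hl : Nat.divide (Nat.lcm a b) (a' * Nat.lcm g b)).
  { apply Nat.lcm_least.
    - rewrite Ha. apply Nat.mul_divide_mono_l, Nat.divide_lcm_l.
    - apply Nat.divide_mul_r, Nat.divide_lcm_r. }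
  destruct (Nat.divide_lcm_l g b) as [t Ht].
  assert (Hd' : Nat.divide d' (a' * t)).
  { apply (Nat.mul_divide_cancel_r _ _ g Hg).
    rewrite <- Hd, <- Nat.mul_assoc, <- Ht. eapply Nat.divide_trans; eauto. }
  apply Nat.gauss in Hd'; [|exact Hcop].
  rewrite Ht, Hd. apply Nat.mul_divide_mono_r, Hd'.
Qed.

(** For the nontrivial direction, [divide_lcm_gcd_l] with d the left-hand side replaces both
    arguments of the lcm by their gcd with d, and d divides c. *)
Lemma gcd_lcm_distr_l (a b c : nat) :
  Nat.gcd (Nat.lcm a b) c = Nat.lcm (Nat.gcd a c) (Nat.gcd b c).
Proof.
  apply Nat.divide_antisym.
  - assert (H1 := Nat.gcd_divide_l (Nat.lcm a b) c).
    assert (H2 := Nat.gcd_divide_r (Nat.lcm a b) c).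
    set (d := Nat.gcd (Nat.lcm a b) c) in *.
    apply divide_lcm_gcd_l in H1. rewrite Nat.lcm_comm in H1.
    apply divide_lcm_gcd_l in H1. rewrite Nat.lcm_comm in H1.
    eapply Nat.divide_trans; [exact H1|].
    apply Nat.lcm_least.
    + eapply Nat.divide_trans; [|apply Nat.divide_lcm_l].
      apply Nat.gcd_greatest; [apply Nat.gcd_divide_l|].
      eapply Nat.divide_trans; [apply Nat.gcd_divide_r|exact H2].
    + eapply Nat.divide_trans; [|apply Nat.divide_lcm_r].
      apply Nat.gcd_greatest; [apply Nat.gcd_divide_l|].
      eapply Nat.divide_trans; [apply Nat.gcd_divide_r|exact H2].
  - apply Nat.lcm_least; apply Nat.gcd_greatest; try apply Nat.gcd_divide_r.
    + eapply Nat.divide_trans; [apply Nat.gcd_divide_l|apply Nat.divide_lcm_l].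
    + eapply Nat.divide_trans; [apply Nat.gcd_divide_l|apply Nat.divide_lcm_r].
Qed.

Lemma gcd_mul_lcm (a b : nat) : (Nat.lcm a b * Nat.gcd a b = a * b)%nat.
Proof.
  destruct (Nat.eq_dec (Nat.gcd a b) 0) as [Hg|Hg].
  { apply Nat.gcd_eq_0 in Hg. destruct Hg as [-> ->]. reflexivity. }
  unfold Nat.lcm. rewrite <- Nat.mul_assoc. f_equal.
  destruct (Nat.gcd_divide_r a b) as [q Hq].
  rewrite Hq at 1. rewrite Nat.div_mul by exact Hg. lia.
Qed.

(** The restriction to odd indices is what lets [pell_x] qualify: X_2 = 2 X_1^2 - 1 is coprime to
    X_1. *)
Definition odd_strong_divisibility (f : nat -> nat) : Prop :=
  forall a b, Nat.Odd a -> Nat.Odd b -> Nat.gcd (f a) (f b) = f (Nat.gcd a b).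

(** A Euclidean algorithm that preserves parity: for b < a, replace a by a - 2b if 2b <= a and by 2b
    - a otherwise. Both moves keep the indices odd, decrease a, and preserve both gcds. *)
Lemma odd_strong_divisibility_intro (f : nat -> nat) :
  (forall a b d, Nat.divide d (f b) ->
     (Nat.divide d (f (a + 2 * b)%nat) <-> Nat.divide d (f a))) ->
  (forall a a' b d, (a + a' = 2 * b)%nat -> Nat.divide d (f b) ->
     Nat.divide d (f a) -> Nat.divide d (f a')) ->
  odd_strong_divisibility f.
Proof.
  intros Htrans Hrefl.
  assert (Hmain : forall k a b, (a + b <= k)%nat -> Nat.Odd a -> Nat.Odd b ->
    Nat.gcd (f a) (f b) = f (Nat.gcd a b)).
  { induction k as [|k IH]; intros a b Hk Ha Hb.
    { destruct Ha. lia. }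
    assert (Hlt : forall a b, (a + b <= S k)%nat -> (b < a)%nat -> Nat.Odd a ->
      Nat.Odd b -> Nat.gcd (f a) (f b) = f (Nat.gcd a b)).
    { clear a b Hk Ha Hb. intros a b Hk Hab [p Ha] [q Hb].
      assert (exists a', Nat.Odd a' /\ (a' < a)%nat /\ Nat.gcd a b = Nat.gcd a' b /\
        forall d, Nat.divide d (f b) -> (Nat.divide d (f a) <-> Nat.divide d (f a')))
        as [a' [Ha' [Hlt [Hg Hd]]]].
      { destruct (Nat.le_gt_cases (2 * b) a) as [H|H].
        - exists (a - 2 * b)%nat. repeat split.
          + exists (p - 2 * q - 1)%nat. lia.
          + lia.
          + rewrite (Nat.gcd_comm a), (Nat.gcd_comm (a - _)).
            replace a with (a - 2 * b + 2 * b)%nat at 1 by lia.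
            apply Nat.gcd_add_mult_diag_r.
          + replace a with (a - 2 * b + 2 * b)%nat at 1 by lia.
            apply Htrans; assumption.
          + replace a with (a - 2 * b + 2 * b)%nat at 2 by lia.
            apply Htrans; assumption.
        - exists (2 * b - a)%nat. repeat split.
          + exists (2 * q - p)%nat. lia.
          + lia.
          + apply Nat.divide_antisym; apply Nat.gcd_greatest;
              try apply Nat.gcd_divide_r.
            * apply Nat.divide_sub_r; [|apply Nat.gcd_divide_l].
              apply Nat.divide_mul_r, Nat.gcd_divide_r.
            * replace a with (2 * b - (2 * b - a))%nat at 2 by lia.
              apply Nat.divide_sub_r; [|apply Nat.gcd_divide_l].
              apply Nat.divide_mul_r, Nat.gcd_divide_r.
          + apply Hrefl with b; [lia|assumption].
          + apply Hrefl with b; [lia|assumption]. }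
      rewrite Hg, <- (IH a' b); [|lia|assumption|exists q; assumption].
      apply Nat.divide_antisym; apply Nat.gcd_greatest;
        try apply Nat.gcd_divide_r; apply Hd;
        try apply Nat.gcd_divide_r; apply Nat.gcd_divide_l. }
    destruct (Nat.lt_total a b) as [H|[<-|H]].
    - rewrite Nat.gcd_comm, (Nat.gcd_comm a). apply Hlt; auto; lia.
    - rewrite !Nat.gcd_diag. reflexivity.
    - apply Hlt; auto. }
  intros a b. apply (Hmain (a + b)%nat). lia.
Qed.

(* [fermat_prod k] is the product F_0 ... F_(k-1) = 2^(2^k) - 1 of the first [k]
   Fermat numbers, and F_k = fermat_prod k + 2. *)
Fixpoint fermat_prod (k : nat) : nat :=
  match k with
  | O => 1
  | S k => fermat_prod k * (fermat_prod k + 2)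
  end.

Lemma fermat_prod_odd (k : nat) : Nat.Odd (fermat_prod k).
Proof.
  induction k as [|k IH]; cbn [fermat_prod].
  - exists 0%nat. reflexivity.
  - apply Nat.Odd_mul; [exact IH|]. destruct IH as [m ->]. exists (m + 1)%nat. lia.
Qed.

(** A common divisor divides 2 and the odd number [fermat_prod k]. *)
Lemma fermat_coprime (k : nat) : Nat.gcd (fermat_prod k + 2) (fermat_prod k) = 1%nat.
Proof.
  destruct (fermat_prod_odd k) as [m Hm].
  apply Nat.divide_1_r.
  set (g := Nat.gcd _ _).
  assert (H1 : Nat.divide g (fermat_prod k)) by apply Nat.gcd_divide_r.
  assert (H2 : Nat.divide g 2).
  { apply (Nat.divide_add_cancel_r g (fermat_prod k)); [exact H1|].
    apply Nat.gcd_divide_l. }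
  apply (Nat.divide_add_cancel_r g (2 * m)).
  - apply Nat.divide_mul_l, H2.
  - rewrite <- Hm. exact H1.
Qed.

(* The least common multiple of the values of [f] at [fermat_prod k * l / F_i],
   for [i < k]. *)
Fixpoint fermat_lcm (f : nat -> nat) (k l : nat) : nat :=
  match k with
  | O => 1
  | S k => Nat.lcm (fermat_lcm f k ((fermat_prod k + 2) * l)) (f (fermat_prod k * l)%nat)
  end.

Section FermatLcm.

Variable f : nat -> nat.
Hypothesis f_gcd : odd_strong_divisibility f.

Lemma odd_divide (a b : nat) : Nat.Odd a -> Nat.Odd b ->
  Nat.divide a b -> Nat.divide (f a) (f b).
Proof.
  intros Ha Hb H. apply Nat.divide_gcd_iff. rewrite f_gcd by assumption.
  f_equal. apply Nat.divide_gcd_iff, H.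
Qed.

Lemma fermat_lcm_divide (k l : nat) : Nat.Odd l ->
  Nat.divide (fermat_lcm f k l) (f (fermat_prod k * l)%nat).
Proof.
  revert l. induction k as [|k IH]; intros l Hl; cbn [fermat_lcm fermat_prod].
  - apply Nat.divide_1_l.
  - pose proof (fermat_prod_odd k) as HP.
    assert (HF : Nat.Odd (fermat_prod k + 2)).
    { destruct HP as [m ->]. exists (m + 1)%nat. lia. }
    apply Nat.lcm_least.
    + rewrite <- Nat.mul_assoc. apply IH. apply Nat.Odd_mul; assumption.
    + apply odd_divide.
      * apply Nat.Odd_mul; assumption.
      * repeat apply Nat.Odd_mul; assumption.
      * exists (fermat_prod k + 2)%nat. lia.
Qed.

(** The gcd distributes over the lcm, and each term loses the factor q: with P = [fermat_prod k],
    the gcd of q P l / F_i and P l is P l / F_i because q is coprime to F_i. *)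
Lemma gcd_fermat_lcm (k q l : nat) : Nat.Odd q -> Nat.Odd l ->
  Nat.gcd q (fermat_prod k) = 1%nat ->
  Nat.gcd (fermat_lcm f k (q * l)) (f (fermat_prod k * l)%nat) = fermat_lcm f k l.
Proof.
  revert q l. induction k as [|k IH]; intros q l Hq Hl Hcop; cbn [fermat_lcm].
  - apply Nat.divide_1_r, Nat.gcd_divide_l.
  - cbn [fermat_prod] in *.
    pose proof (fermat_prod_odd k) as HP.
    set (P := fermat_prod k) in *. set (F := (P + 2)%nat) in *.
    assert (HF : Nat.Odd F).
    { unfold F. destruct HP as [m ->]. exists (m + 1)%nat. lia. }
    assert (HqP : Nat.gcd q P = 1%nat).
    { apply Nat.divide_1_r. rewrite <- Hcop. apply Nat.gcd_greatest.
      - apply Nat.gcd_divide_l.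
      - apply Nat.divide_mul_l, Nat.gcd_divide_r. }
    assert (HqF : Nat.gcd q F = 1%nat).
    { apply Nat.divide_1_r. rewrite <- Hcop. apply Nat.gcd_greatest.
      - apply Nat.gcd_divide_l.
      - apply Nat.divide_mul_r, Nat.gcd_divide_r. }
    rewrite gcd_lcm_distr_l. f_equal.
    + replace (F * (q * l))%nat with (q * (F * l))%nat by ring.
      rewrite <- Nat.mul_assoc. apply IH; auto. apply Nat.Odd_mul; assumption.
    + rewrite f_gcd by (repeat apply Nat.Odd_mul; assumption). f_equal.
      replace (P * (q * l))%nat with (q * (P * l))%nat by ring.
      replace (P * F * l)%nat with (F * (P * l))%nat by ring.
      rewrite Nat.gcd_mul_mono_r, HqF. lia.
Qed.

(** One step of inclusion-exclusion: lcm times gcd is the product, and [gcd_fermat_lcm] with q = F_k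
    evaluates the gcd as [fermat_lcm f k l]. This determines sizes recursively. *)
Lemma fermat_lcm_succ (k l : nat) : Nat.Odd l ->
  (fermat_lcm f (S k) l * fermat_lcm f k l =
   fermat_lcm f k ((fermat_prod k + 2) * l) * f (fermat_prod k * l))%nat.
Proof.
  intros Hl. cbn [fermat_lcm].
  rewrite <- (gcd_fermat_lcm k (fermat_prod k + 2) l).
  - apply gcd_mul_lcm.
  - destruct (fermat_prod_odd k) as [m ->]. exists (m + 1)%nat. lia.
  - exact Hl.
  - apply fermat_coprime.
Qed.

(* The exponent [(fermat_prod k - 1) / 2] comes from the Fermat product
   (1 - 1/F_0) ... (1 - 1/F_(k-1)) = (1 + 1 / fermat_prod k) / 2. *)
Lemma fermat_lcm_growth (w c : R) (k : nat) :
  0 < w -> 0 < c ->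
  (forall n, Nat.Odd n -> c * w ^ n <= INR (f n) <= / c * w ^ n) ->
  exists (h : nat) (c' : R), (2 * h + 1 = fermat_prod k)%nat /\ 0 < c' /\
    forall l, Nat.Odd l ->
      c' * w ^ (h * l) <= INR (fermat_lcm f k l) <= / c' * w ^ (h * l).
Proof.
  intros Hw Hc Hf. induction k as [|k [h [c' [Hh [Hc' IH]]]]].
  - exists 0%nat, 1. repeat split; [lra| |]; cbn; lra.
  - set (P := fermat_prod k) in *.
    (* By [fermat_lcm_succ] the new exponent plus h must be h (P + 2) + P. The constant collects one
       factor from each of the three known sizes. *)
    exists (h * (P + 2) + P - h)%nat, (c' * c * c').
    assert (Hcc : 0 < c' * c * c') by (repeat apply Rmult_lt_0_compat; assumption).
    split; [cbn; fold P; nia|]. split; [exact Hcc|].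
    intros l Hl.
    pose proof (f_equal INR (fermat_lcm_succ k l Hl)) as E. fold P in E.
    rewrite !mult_INR in E.
    assert (HP : Nat.Odd P) by apply fermat_prod_odd.
    assert (HF : Nat.Odd (P + 2)). { destruct HP as [m ->]. exists (m + 1)%nat. lia. }
    destruct (IH l Hl) as [A1 A2].
    destruct (IH ((P + 2) * l)%nat (Nat.Odd_mul _ _ HF Hl)) as [B1 B2].
    destruct (Hf (P * l)%nat (Nat.Odd_mul _ _ HP Hl)) as [C1 C2].
    set (x := INR (fermat_lcm f (S k) l)) in *.
    set (y := INR (fermat_lcm f k l)) in *.
    set (z := INR (fermat_lcm f k ((P + 2) * l))) in *.
    set (v := INR (f (P * l))) in *.
    assert (Hexp : w ^ ((h * (P + 2) + P - h) * l) * w ^ (h * l) =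
      w ^ (h * ((P + 2) * l)) * w ^ (P * l)).
    { rewrite <- !pow_add. f_equal. nia. }
    set (W := w ^ ((h * (P + 2) + P - h) * l)) in *.
    assert (HW1 : 0 < w ^ (h * l)) by (apply pow_lt, Hw).
    assert (HW2 : 0 < w ^ (h * ((P + 2) * l))) by (apply pow_lt, Hw).
    assert (HW3 : 0 < w ^ (P * l)) by (apply pow_lt, Hw).
    set (W1 := w ^ (h * l)) in *. set (W2 := w ^ (h * ((P + 2) * l))) in *.
    set (W3 := w ^ (P * l)) in *.
    assert (Hi : 0 < / c) by (apply Rinv_0_lt_compat, Hc).
    assert (Hi' : 0 < / c') by (apply Rinv_0_lt_compat, Hc').
    assert (Hy : 0 < y) by (assert (0 < c' * W1) by nra; lra).
    split; apply Rmult_le_reg_r with y; try exact Hy; rewrite E.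
    + apply Rle_trans with (c' * c * c' * W * (/ c' * W1)).
      * apply Rmult_le_compat_l; [|exact A2].
        assert (0 < W) by (apply pow_lt, Hw). nra.
      * replace (c' * c * c' * W * (/ c' * W1)) with (c' * c * (W * W1)) by (field; lra).
        rewrite Hexp.
        replace (c' * c * (W2 * W3)) with ((c' * W2) * (c * W3)) by ring.
        apply Rmult_le_compat; nra.
    + apply Rle_trans with (/ (c' * c * c') * W * (c' * W1)).
      * replace (/ (c' * c * c') * W * (c' * W1)) with (/ c' * / c * (W * W1)) by (field; lra).
        rewrite Hexp.
        replace (/ c' * / c * (W2 * W3)) with ((/ c' * W2) * (/ c * W3)) by ring.
        apply Rmult_le_compat; nra.
      * apply Rmult_le_compat_l; [|exact A1].
        assert (0 < W) by (apply pow_lt, Hw).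
        assert (0 < / (c' * c * c')) by (apply Rinv_0_lt_compat, Hcc). nra.
Qed.

End FermatLcm.

(** The divisor [fermat_lcm f k l] has size w^(h l), so its cofactor has size w^((h+1) l), which
    dominates both. Ordering the factors as b <= a later keeps 2a - b and 2c - d positive. *)
Lemma balanced_factorization (f : nat -> nat) (w c : R) (k h : nat) :
  odd_strong_divisibility f -> 1 < w -> 0 < c ->
  (forall n, Nat.Odd n -> c * w ^ n <= INR (f n) <= / c * w ^ n) ->
  (2 * h + 1 = fermat_prod k)%nat ->
  exists C, 0 < C /\ forall l, Nat.Odd l ->
    exists a b, (a * b = f ((2 * h + 1) * l))%nat /\ (1 <= b <= a)%nat /\
      INR a <= C * w ^ ((h + 1) * l).
Proof.
  intros Hf Hw Hc Hg Hh.
  destruct (fermat_lcm_growth f Hf w c k) as [h' [c' [Hh' [Hc' HL]]]]; auto; [lra|].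
  replace h' with h in HL by lia. clear h' Hh'.
  assert (Hi : 0 < / c) by (apply Rinv_0_lt_compat, Hc).
  assert (Hi' : 0 < / c') by (apply Rinv_0_lt_compat, Hc').
  (* The first summand bounds the lcm, the second its cofactor. *)
  exists (/ c' + / c * / c'). split; [nra|].
  intros l Hl.
  destruct (fermat_lcm_divide f Hf k l Hl) as [b Hb].
  rewrite <- Hh in Hb.
  assert (Hodd : Nat.Odd ((2 * h + 1) * l)).
  { apply Nat.Odd_mul; [exists h; reflexivity|exact Hl]. }
  destruct (Hg _ Hodd) as [F1 F2]. destruct (HL l Hl) as [L1 L2].
  set (a := fermat_lcm f k l) in *.
  assert (HW : 1 <= w ^ l) by (apply pow_R1_Rle; lra).
  assert (HA : 0 < w ^ (h * l)) by (apply pow_lt; lra).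
  assert (HB : w ^ ((h + 1) * l) = w ^ (h * l) * w ^ l)
    by (rewrite <- pow_add; f_equal; ring).
  assert (HF : w ^ ((2 * h + 1) * l) = w ^ (h * l) * (w ^ (h * l) * w ^ l))
    by (rewrite <- !pow_add; f_equal; ring).
  rewrite HF in F1, F2. rewrite HB.
  set (V := w ^ (h * l)) in *. set (W := w ^ l) in *.
  assert (HVW : 0 < V * W) by nra.
  assert (HVVW : 0 < V * (V * W)) by nra.
  pose proof (f_equal INR Hb) as E. rewrite mult_INR in E.
  assert (Hfpos : 0 < INR b * INR a) by nra.
  assert (Hpos : (0 < b * a)%nat).
  { rewrite <- mult_INR in Hfpos. apply INR_lt. exact Hfpos. }
  assert (Ha : INR a <= (/ c' + / c * / c') * (V * W)).
  { apply Rle_trans with (/ c' * (V * W)).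
    - apply Rle_trans with (/ c' * V); [exact L2|]. apply Rmult_le_compat_l; nra.
    - apply Rmult_le_compat_r; nra. }
  assert (HbR : INR b <= (/ c' + / c * / c') * (V * W)).
  { apply Rle_trans with (/ c * / c' * (V * W)).
    - apply Rmult_le_reg_r with (c' * V); [apply Rmult_lt_0_compat; lra|].
      replace (/ c * / c' * (V * W) * (c' * V)) with (/ c * (V * (V * W))) by (field; lra).
      apply Rle_trans with (INR b * INR a); [|rewrite <- E; exact F2].
      apply Rmult_le_compat_l; [apply pos_INR|exact L1].
    - apply Rmult_le_compat_r; nra. }
  destruct (Nat.le_ge_cases a b) as [H|H].
  - exists b, a. repeat split; auto; nia.
  - exists a, b. repeat split; auto; nia.
Qed.

(** * Powers of a Pell unit *)

Lemma divide_summand (d m n p : nat) :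
  (m + n = p)%nat -> Nat.divide d p -> Nat.divide d m -> Nat.divide d n.
Proof.
  intros <- Hp Hm. exact (Nat.divide_add_cancel_r _ _ _ Hm Hp).
Qed.

(** Centred at b with step |b - a|, the identity makes f a + f a' a multiple of f b. *)
Lemma divide_reflect (f g : nat -> nat) :
  (forall a b, (f (a + 2 * b) + f a = 2 * (g b * f (a + b)))%nat) ->
  forall a a' b d, (a + a' = 2 * b)%nat -> Nat.divide d (f b) ->
    Nat.divide d (f a) -> Nat.divide d (f a').
Proof.
  intros H a a' b d E Hb Ha.
  destruct (Nat.le_ge_cases a a') as [L|L].
  - apply divide_summand with (f a) (2 * (g (b - a) * f b))%nat; auto.
    + rewrite Nat.add_comm. replace a' with (a + 2 * (b - a))%nat by lia.
      rewrite H. replace (a + (b - a))%nat with b by lia. reflexivity.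
    + do 2 apply Nat.divide_mul_r. exact Hb.
  - apply divide_summand with (f a) (2 * (g (b - a') * f b))%nat; auto.
    + replace a with (a' + 2 * (b - a'))%nat by lia.
      rewrite H. replace (a' + (b - a'))%nat with b by lia. reflexivity.
    + do 2 apply Nat.divide_mul_r. exact Hb.
Qed.

(** The coordinates of (x + y sqrt D)^n in the basis 1, sqrt D. *)
Fixpoint pell_pow (D x y n : nat) : nat * nat :=
  match n with
  | O => (1, 0)%nat
  | S n => let p := pell_pow D x y n in
      (x * fst p + D * (y * snd p), x * snd p + y * fst p)%nat
  end.

Definition pell_x (D x y n : nat) : nat := fst (pell_pow D x y n).
Definition pell_y (D x y n : nat) : nat := snd (pell_pow D x y n).

Section PellPow.

Variables D x y : nat.
Hypothesis D_pos : (1 <= D)%nat.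
Hypothesis y_pos : (1 <= y)%nat.
Hypothesis pell : (x * x = D * (y * y) + 1)%nat.

Local Notation X := (pell_x D x y).
Local Notation Y := (pell_y D x y).
Let s := sqrt (INR D).
Let w := INR x + INR y * s.
Let w' := INR x - INR y * s.

Lemma pell_add (m n : nat) :
  X (m + n) = (X m * X n + D * (Y m * Y n))%nat /\
  Y (m + n) = (X m * Y n + Y m * X n)%nat.
Proof.
  induction m as [|m [IHx IHy]].
  - unfold pell_x, pell_y; cbn; lia.
  - unfold pell_x, pell_y in *; cbn. rewrite IHx, IHy. split; ring.
Qed.

Lemma pell_norm (n : nat) : (X n * X n = D * (Y n * Y n) + 1)%nat.
Proof.
  induction n as [|n IH].
  - unfold pell_x, pell_y; cbn; lia.
  - change (X (S n)) with (x * X n + D * (y * Y n))%nat.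
    change (Y (S n)) with (x * Y n + y * X n)%nat.
    transitivity ((x * x) * (X n * X n) + 2 * D * x * y * X n * Y n
      + D * (y * y) * (D * (Y n * Y n)))%nat; [ring|].
    transitivity (D * ((x * x) * (Y n * Y n)) + D * (y * y) * (X n * X n)
      + 2 * D * x * y * X n * Y n + 1)%nat; [|ring].
    rewrite IH, pell. ring.
Qed.

(** With X as cosh and Y sqrt D as sinh, this is the sum-to-product formula for cosh; the next two
    lemmas are those for sinh. *)
Lemma pell_x_reflection (a b : nat) :
  (X (a + 2 * b) + X a = 2 * (X b * X (a + b)))%nat.
Proof.
  replace (a + 2 * b)%nat with (a + b + b)%nat by lia.
  destruct (pell_add (a + b) b) as [-> _]. destruct (pell_add a b) as [-> ->].
  transitivity (X a * (X b * X b + (D * (Y b * Y b) + 1)) + 2 * D * X b * Y a * Y b)%nat;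
    [ring|].
  rewrite <- pell_norm. ring.
Qed.

(** Translation by 2b needs a multiple of Y b, which the difference of two values of Y provides; the
    sum in [pell_y_reflection] serves the reflection. For X one identity does both. *)
Lemma pell_y_translation (a b : nat) :
  Y (a + 2 * b) = (Y a + 2 * (Y b * X (a + b)))%nat.
Proof.
  replace (a + 2 * b)%nat with (a + b + b)%nat by lia.
  destruct (pell_add (a + b) b) as [_ ->]. destruct (pell_add a b) as [-> ->].
  transitivity (2 * X a * X b * Y b + Y a * (D * (Y b * Y b)) + Y a * (X b * X b))%nat;
    [ring|].
  rewrite pell_norm. ring.
Qed.

Lemma pell_y_reflection (a b : nat) :
  (Y (a + 2 * b) + Y a = 2 * (X b * Y (a + b)))%nat.
Proof.
  replace (a + 2 * b)%nat with (a + b + b)%nat by lia.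
  destruct (pell_add (a + b) b) as [_ ->]. destruct (pell_add a b) as [-> ->].
  transitivity (Y a * (X b * X b + (D * (Y b * Y b) + 1)) + 2 * X a * X b * Y b)%nat;
    [ring|].
  rewrite <- pell_norm. ring.
Qed.

Lemma pell_x_gcd : odd_strong_divisibility X.
Proof.
  apply odd_strong_divisibility_intro.
  - intros a b d Hb. pose proof (pell_x_reflection a b) as E.
    split; apply divide_summand with (2 * (X b * X (a + b)))%nat; try lia;
      apply Nat.divide_mul_r, Nat.divide_mul_l, Hb.
  - apply divide_reflect with X. exact pell_x_reflection.
Qed.

Lemma pell_y_gcd : odd_strong_divisibility Y.
Proof.
  apply odd_strong_divisibility_intro.
  - intros a b d Hb. rewrite pell_y_translation.
    assert (H : Nat.divide d (2 * (Y b * X (a + b)))%nat)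
      by apply Nat.divide_mul_r, Nat.divide_mul_l, Hb.
    split; intro Ha.
    + rewrite Nat.add_comm in Ha. exact (Nat.divide_add_cancel_r _ _ _ H Ha).
    + apply Nat.divide_add_r; assumption.
  - apply divide_reflect with X. exact pell_y_reflection.
Qed.

Lemma sqrt_D_sqr : s * s = INR D.
Proof. apply sqrt_sqrt, pos_INR. Qed.

Lemma sqrt_D_pos : 1 <= s.
Proof.
  unfold s. rewrite <- sqrt_1. apply sqrt_le_1_alt.
  change 1 with (INR 1). apply le_INR. exact D_pos.
Qed.

Lemma pell_unit_inv : w * w' = 1.
Proof.
  pose proof (f_equal INR pell) as E. rewrite plus_INR, !mult_INR in E.
  rewrite <- sqrt_D_sqr in E. cbn [INR] in E. unfold w, w'. nra.
Qed.

Lemma pell_unit_gt_1 : 1 < w.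
Proof.
  unfold w. pose proof sqrt_D_pos.
  assert (1 <= INR y) by (change 1 with (INR 1); apply le_INR, y_pos).
  assert (1 <= INR x) by (change 1 with (INR 1); apply le_INR; nia).
  nra.
Qed.

Lemma pell_unit_conj : 0 < w' < 1.
Proof.
  pose proof pell_unit_inv. pose proof pell_unit_gt_1.
  assert (0 < w') by nra. nra.
Qed.

Lemma pell_pow_real (n : nat) :
  INR (X n) + INR (Y n) * s = w ^ n /\ INR (X n) - INR (Y n) * s = w' ^ n.
Proof.
  induction n as [|n [IH1 IH2]].
  - unfold pell_x, pell_y; cbn; lra.
  - change (X (S n)) with (x * X n + D * (y * Y n))%nat.
    change (Y (S n)) with (x * Y n + y * X n)%nat.
    rewrite !plus_INR, !mult_INR. cbn [pow].
    rewrite <- IH1, <- IH2, <- sqrt_D_sqr. unfold w, w'. split; ring.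
Qed.

Lemma pell_x_growth (n : nat) : / 2 * w ^ n <= INR (X n) <= / / 2 * w ^ n.
Proof.
  destruct (pell_pow_real n) as [H1 H2].
  pose proof pell_unit_gt_1 as Hw. pose proof pell_unit_conj as Hw'.
  assert (0 < w' ^ n) by (apply pow_lt; lra).
  assert (w' ^ n <= w ^ n) by (apply pow_incr; lra).
  rewrite Rinv_inv. lra.
Qed.

(** Y n = (w^n - w'^n) / (2 s). An odd n is at least 1, so w'^n <= w' w^n, which gives the lower
    constant; at n = 0 the value Y 0 = 0 would break it. *)
Lemma pell_y_growth :
  exists c, 0 < c /\ forall n, Nat.Odd n -> c * w ^ n <= INR (Y n) <= / c * w ^ n.
Proof.
  pose proof pell_unit_gt_1 as Hw. pose proof pell_unit_conj as Hw'.
  pose proof sqrt_D_pos as Hs. pose proof pell_unit_inv as Hinv.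
  exists ((1 - w') * / (2 * s)).
  assert (Hi : 0 < / (2 * s)) by (apply Rinv_0_lt_compat; lra).
  assert (Hi2 : / (2 * s) * (2 * s) = 1) by (apply Rinv_l; lra).
  assert (Hc : 0 < (1 - w') * / (2 * s)) by (apply Rmult_lt_0_compat; lra).
  split; [exact Hc|].
  intros n [m Hm].
  destruct (pell_pow_real n) as [H1 H2].
  assert (Hn : 0 < w' ^ n) by (apply pow_lt; lra).
  assert (HW : 0 < w ^ n) by (apply pow_lt; lra).
  assert (Hlow : w' ^ n <= w' * w ^ n).
  { replace n with (S (2 * m)) by lia. cbn [pow].
    rewrite <- Rmult_assoc, (Rmult_comm w' w), Hinv, Rmult_1_l.
    apply Rle_trans with (w' * 1).
    - apply Rmult_le_compat_l; [lra|]. rewrite <- (pow1 (2 * m)). apply pow_incr. lra.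
    - apply Rle_trans with 1; [lra|]. apply pow_R1_Rle. lra. }
  assert (HY : INR (Y n) = (w ^ n - w' ^ n) * / (2 * s)).
  { apply Rmult_eq_reg_r with (2 * s); [|lra]. rewrite Rmult_assoc, Hi2. lra. }
  rewrite HY. split.
  - replace ((1 - w') * / (2 * s) * w ^ n) with ((w ^ n - w' * w ^ n) * / (2 * s)) by ring.
    apply Rmult_le_compat_r; lra.
  - assert (Hi1 : / (2 * s) <= 1) by (rewrite <- Rinv_1; apply Rinv_le_contravar; lra).
    apply Rle_trans with (w ^ n * 1).
    + apply Rmult_le_compat; nra.
    + rewrite Rmult_comm. apply Rmult_le_compat_r; [lra|].
      rewrite <- Rinv_1 at 1. apply Rinv_le_contravar; [exact Hc|].
      nra.
Qed.

Lemma pell_approximation (n : nat) : INR (X n) - s * INR (Y n) = / w ^ n.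
Proof.
  destruct (pell_pow_real n) as [_ H].
  pose proof pell_unit_gt_1 as Hw.
  assert (0 < w ^ n) by (apply pow_lt; lra).
  apply Rmult_eq_reg_r with (w ^ n); [|lra].
  rewrite Rinv_l by lra. rewrite (Rmult_comm s), H, <- Rpow_mult_distr.
  rewrite (Rmult_comm w' w), pell_unit_inv, pow1. reflexivity.
Qed.

End PellPow.

(** * Gaps between eigenvalues *)

Definition below (x : R) (l : list R) : list R :=
  filter (fun z => if Rlt_dec z x then true else false) l.

Lemma in_below (x z : R) (l : list R) : In z (below x l) <-> In z l /\ z < x.
Proof.
  unfold below. rewrite filter_In. destruct (Rlt_dec z x); intuition congruence.
Qed.

(** All these eigenvalues come from a J by J grid of pairs. Removing repeated values makes the list
    count eigenvalues in the way [is_kth_eigval] does. *)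
Lemma eigval_below_finite (alpha y : R) (J : nat) :
  (forall m n : nat, (1 <= m)%nat -> (1 <= n)%nat ->
     alpha * INR m ^ 2 + INR n ^ 2 < y -> (m <= J)%nat /\ (n <= J)%nat) ->
  exists l, NoDup l /\ (length l <= J * J)%nat /\
    forall z, In z l <-> eigval alpha z /\ z < y.
Proof.
  intros HJ.
  set (g := fun p : nat * nat => alpha * INR (fst p) ^ 2 + INR (snd p) ^ 2).
  set (grid := map g (list_prod (seq 1 J) (seq 1 J))).
  exists (nodup Req_dec_T (below y grid)). split; [apply NoDup_nodup|]. split.
  - apply Nat.le_trans with (length grid).
    + apply NoDup_incl_length; [apply NoDup_nodup|].
      intros z Hz. apply nodup_In, in_below in Hz. tauto.
    + unfold grid. rewrite length_map, length_prod, length_seq. lia.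
  - intros z. rewrite nodup_In, in_below. split.
    + intros [Hz Hlt]. split; [|exact Hlt].
      apply in_map_iff in Hz. destruct Hz as [[m n] [<- Hmn]].
      apply in_prod_iff in Hmn. rewrite !in_seq in Hmn.
      exists m, n. repeat split; lia.
    + intros [[m [n [Hm [Hn ->]]]] Hlt]. split; [|exact Hlt].
      apply in_map_iff. exists (m, n). split; [reflexivity|].
      destruct (HJ m n Hm Hn Hlt). apply in_prod; apply in_seq; lia.
Qed.

Lemma list_minimum (x : R) (l : list R) :
  exists m, In m (x :: l) /\ forall z, In z (x :: l) -> m <= z.
Proof.
  revert x. induction l as [|a l IH]; intros x.
  - exists x. split; [left; reflexivity|]. intros z [->|[]]. lra.
  - destruct (IH a) as [m [Hm Hmin]]. destruct (Rle_dec x m) as [H|H].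
    + exists x. split; [left; reflexivity|].
      intros z [->|Hz]; [lra|]. apply Hmin in Hz. lra.
    + exists m. split; [right; exact Hm|].
      intros z [->|Hz]; [lra|]. apply Hmin, Hz.
Qed.

(** If x < y, the eigenvalues below y include x and everything below x, so the two counts cannot
    agree. This pins down the choice made by [lam]. *)
Lemma is_kth_eigval_inj (alpha : R) (k : nat) (x y : R) :
  is_kth_eigval alpha k x -> is_kth_eigval alpha k y -> x = y.
Proof.
  assert (H : forall x y, is_kth_eigval alpha k x -> is_kth_eigval alpha k y -> ~ x < y).
  { clear. intros x y [Ex [lx [Nx [Lx Hx]]]] [_ [ly [Ny [Ly Hy]]]] Hlt.
    assert (Hle : (length (x :: lx) <= length ly)%nat).
    { apply NoDup_incl_length.
      - constructor; [|exact Nx]. rewrite Hx. lra.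
      - intros z [<-|Hz].
        + apply Hy. auto.
        + apply Hx in Hz. apply Hy. split; [tauto|lra]. }
    cbn in Hle. lia. }
  intros Hx Hy. destruct (Rtotal_order x y) as [L|[E|L]]; [|exact E|].
  - exfalso. exact (H x y Hx Hy L).
  - exfalso. exact (H y x Hy Hx L).
Qed.

Lemma lam_eq (alpha : R) (k : nat) (x : R) : is_kth_eigval alpha k x -> lam alpha k = x.
Proof.
  intros H. apply is_kth_eigval_inj with alpha k; [|exact H].
  unfold lam. apply epsilon_spec. exists x. exact H.
Qed.

Lemma fold_Rmin_le_init (a : R) (l : list R) : fold_right Rmin a l <= a.
Proof.
  induction l as [|b l IH]; cbn; [lra|].
  eapply Rle_trans; [apply Rmin_r|exact IH].
Qed.

Lemma fold_Rmin_le (a x : R) (l : list R) : In x l -> fold_right Rmin a l <= x.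
Proof.
  induction l as [|b l IH]; intros []; cbn.
  - subst. apply Rmin_l.
  - eapply Rle_trans; [apply Rmin_r|auto].
Qed.

(** The eigenvalues x and y need not be consecutive: the successor of x is at most y. Fewer than N
    eigenvalues lie below y, and x is one of them, so its index is less than N. *)
Lemma delta_min_le (alpha x y : R) (J N : nat) :
  (forall m n : nat, (1 <= m)%nat -> (1 <= n)%nat ->
     alpha * INR m ^ 2 + INR n ^ 2 < y -> (m <= J)%nat /\ (n <= J)%nat) ->
  (J * J < N)%nat ->
  eigval alpha x -> eigval alpha y -> x < y ->
  delta_min alpha N <= y - x.
Proof.
  intros HJ HN Ex Ey Hxy.
  destruct (eigval_below_finite alpha y J HJ) as [ly [Ny [Ly Hy]]].
  set (lx := below x ly).
  assert (Hx : forall z, In z lx <-> eigval alpha z /\ z < x).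
  { intro z. unfold lx. rewrite in_below, Hy. split; [tauto|].
    intros [H1 H2]. repeat split; auto; lra. }
  assert (Nx : NoDup lx) by (apply NoDup_filter, Ny).
  (* The least element among y and the eigenvalues strictly between x and y is the successor of
     x. *)
  destruct (list_minimum y (filter (fun z => if Rlt_dec x z then true else false) ly))
    as [x' [Hx' Hmin]].
  assert (Hx'_spec : eigval alpha x' /\ x < x').
  { destruct Hx' as [<-|H]; [auto|]. apply filter_In in H. destruct H as [H1 H2].
    apply Hy in H1. destruct (Rlt_dec x x'); [tauto|discriminate]. }
  assert (Hx'y : x' <= y) by (apply Hmin; left; reflexivity).
  assert (Nxx : NoDup (x :: lx)) by (constructor; [rewrite Hx; lra|exact Nx]).
  assert (Hlen : (length (x :: lx) <= length ly)%nat).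
  { apply NoDup_incl_length; [exact Nxx|]. intros z [<-|Hz].
    - apply Hy. auto.
    - apply Hx in Hz. apply Hy. split; [tauto|lra]. }
  cbn in Hlen.
  assert (K1 : is_kth_eigval alpha (S (length lx)) x).
  { split; [exact Ex|]. exists lx. split; [exact Nx|]. split; [lia|exact Hx]. }
  assert (K2 : is_kth_eigval alpha (S (S (length lx))) x').
  { split; [tauto|]. exists (x :: lx). split; [exact Nxx|]. split; [cbn; lia|].
    intros z. split.
    - intros [<-|Hz]; [tauto|]. apply Hx in Hz. split; [tauto|lra].
    - intros [Ez Hz]. destruct (Rtotal_order z x) as [L|[E|L]].
      + right. apply Hx. auto.
      + left. auto.
      + exfalso. assert (x' <= z); [|lra]. apply Hmin. right.
        apply filter_In. split; [apply Hy; split; [exact Ez|lra]|].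
        destruct (Rlt_dec x z); [reflexivity|contradiction]. }
  apply Rle_trans with (x' - x); [|lra].
  unfold delta_min. apply fold_Rmin_le. apply in_map_iff.
  exists (S (length lx)). split.
  - rewrite (lam_eq _ _ _ K1), (lam_eq _ _ _ K2). reflexivity.
  - apply in_seq. lia.
Qed.

(* The pairs are [alpha (2a+b)^2 + (2c-d)^2 < alpha (2a-b)^2 + (2c+d)^2], of
   difference [8 (c d - alpha a b)], where [a b = q Y] and [c d = X] for the
   convergent [X / Y] of [sqrt D = q alpha]. *)
Lemma close_eigenvalues (D q x y k h : nat) :
  (1 <= D)%nat -> (1 <= q)%nat -> (1 <= y)%nat -> (x * x = D * (y * y) + 1)%nat ->
  (2 * h + 1 = fermat_prod k)%nat ->
  let alpha := sqrt (INR D) / INR q in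
  exists w C, 1 < w /\ 0 < C /\ forall l, Nat.Odd l ->
    exists (T : nat) (u v : R), eigval alpha u /\ eigval alpha v /\ u < v /\
      v - u = 8 / w ^ ((2 * h + 1) * l) /\
      v <= 9 * (alpha + 1) * INR T ^ 2 /\ (1 <= T)%nat /\
      INR T <= C * w ^ ((h + 1) * l).
Proof.
  intros HD Hq Hy Hpell Hh alpha.
  set (w := INR x + INR y * sqrt (INR D)).
  assert (Hw : 1 < w) by (apply pell_unit_gt_1; assumption).
  destruct (balanced_factorization (pell_x D x y) w (/ 2) k h) as [Cx [HCx HX]];
    [apply pell_x_gcd; assumption|exact Hw|lra| |exact Hh|].
  { intros n _. apply pell_x_growth; assumption. }
  destruct (pell_y_growth D x y HD Hy Hpell) as [cy [Hcy Hgy]].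
  destruct (balanced_factorization (pell_y D x y) w cy k h) as [Cy [HCy HY]];
    [apply pell_y_gcd; assumption|exact Hw|exact Hcy|exact Hgy|exact Hh|].
  assert (Hq1 : 1 <= INR q) by (change 1 with (INR 1); apply le_INR, Hq).
  exists w, (Cx + INR q * Cy). split; [exact Hw|]. split; [nra|].
  intros l Hl.
  destruct (HX l Hl) as [c [d [Hcd [Hdc Hc]]]].
  destruct (HY l Hl) as [a' [b [Hab [Hba Ha']]]]. clear HX HY.
  pose proof (pell_approximation D x y HD Hy Hpell ((2 * h + 1) * l)) as Happ.
  fold w in Happ. rewrite <- Hcd, <- Hab in Happ.
  assert (HW : 0 < w ^ ((h + 1) * l)) by (apply pow_lt; lra).
  assert (HV : 0 < / w ^ ((2 * h + 1) * l)) by (apply Rinv_0_lt_compat, pow_lt; lra).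
  (* The denominator q of alpha goes into the larger factor, which preserves b <= a. *)
  set (a := (q * a')%nat).
  assert (Hal : alpha * INR a * INR b = sqrt (INR D) * INR (a' * b)).
  { unfold alpha, a. rewrite !mult_INR. field. lra. }
  assert (Halpha : 0 < alpha).
  { unfold alpha. apply Rdiv_lt_0_compat; [|lra]. apply sqrt_lt_R0, lt_0_INR. lia. }
  assert (Haa : (b <= a)%nat) by (unfold a; nia).
  rewrite mult_INR in Happ. rewrite <- Hal in Happ.
  assert (Hdiff : (alpha * INR (2 * a - b) ^ 2 + INR (2 * c + d) ^ 2)
     - (alpha * INR (2 * a + b) ^ 2 + INR (2 * c - d) ^ 2) = 8 / w ^ ((2 * h + 1) * l)).
  { rewrite !minus_INR, !plus_INR, !mult_INR by lia. cbn [INR].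
    unfold Rdiv. rewrite <- Happ. ring. }
  (* With T the maximum of a and c, both 2a - b and 2c + d are at most 3 T, whence the factor 9. *)
  exists (Nat.max a c), (alpha * INR (2 * a + b) ^ 2 + INR (2 * c - d) ^ 2),
    (alpha * INR (2 * a - b) ^ 2 + INR (2 * c + d) ^ 2).
  assert (Hsq : forall m n p : nat, (m <= n * p)%nat -> INR m ^ 2 <= (INR n * INR p) ^ 2).
  { intros m n p H. apply pow_incr. rewrite <- mult_INR. split; [apply pos_INR|].
    apply le_INR, H. }
  repeat split.
  - exists (2 * a + b)%nat, (2 * c - d)%nat. repeat split; lia.
  - exists (2 * a - b)%nat, (2 * c + d)%nat. repeat split; lia.
  - unfold Rdiv in Hdiff. lra.
  - exact Hdiff.
  - pose proof (Hsq (2 * a - b)%nat 3%nat (Nat.max a c) ltac:(lia)) as H1.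
    pose proof (Hsq (2 * c + d)%nat 3%nat (Nat.max a c) ltac:(lia)) as H2.
    apply Rmult_le_compat_l with (r := alpha) in H1; [|lra].
    cbn [INR] in H1, H2. nra.
  - lia.
  - destruct (Nat.max_spec a c) as [[_ ->]|[_ ->]].
    + apply Rle_trans with (1 := Hc). apply Rmult_le_compat_r; nra.
    + unfold a. rewrite mult_INR.
      apply Rle_trans with (INR q * (Cy * w ^ ((h + 1) * l))); [nra|].
      rewrite <- Rmult_assoc. apply Rmult_le_compat_r; nra.
Qed.

(** * From the special pairs to every N *)

Lemma odd_power_bracket (z A N : R) :
  1 < z -> 0 < A -> A * z < N ->
  exists l, Nat.Odd l /\ A * z ^ l < N <= A * z ^ (l + 2).
Proof.
  intros Hz HA HN.
  assert (H : forall n, N <= A * z ^ (2 * n + 1) ->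
    exists l, Nat.Odd l /\ A * z ^ l < N <= A * z ^ (l + 2)).
  { induction n as [|n IH]; intros H.
    - cbn in H. lra.
    - destruct (Rle_lt_dec N (A * z ^ (2 * n + 1))) as [L|L]; [auto|].
      exists (2 * n + 1)%nat. split; [exists n; reflexivity|]. split; [exact L|].
      replace (2 * n + 1 + 2)%nat with (2 * S n + 1)%nat by lia. exact H. }
  destruct (Pow_x_infinity z ltac:(rewrite Rabs_right; lra) (N / A)) as [n Hn].
  apply (H n). specialize (Hn (2 * n + 1)%nat ltac:(lia)).
  rewrite Rabs_right in Hn by (left; apply pow_lt; lra).
  apply Rmult_le_reg_r with (/ A); [apply Rinv_0_lt_compat, HA|].
  replace (A * z ^ (2 * n + 1) * / A) with (z ^ (2 * n + 1)) by (field; lra).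
  unfold Rdiv in Hn. lra.
Qed.

Lemma fermat_prod_ge (k : nat) : (k + 1 <= fermat_prod k)%nat.
Proof. induction k as [|k IH]; cbn [fermat_prod]; nia. Qed.

(** Each odd l gives a gap 8 w^(-(2h+1) l) with O(w^(2(h+1) l)) eigenvalues below it, so the gap is
    about N^(-th) with th = (2h+1)/(2h+2). Consecutive odd l change the count by a bounded factor,
    so every large N is covered up to a constant. *)
Lemma delta_min_bound (D q x y : nat) (eps : R) :
  (1 <= D)%nat -> (1 <= q)%nat -> (1 <= y)%nat -> (x * x = D * (y * y) + 1)%nat ->
  0 < eps ->
  exists C : R, 0 < C /\ forall N : nat, (2 <= N)%nat ->
    delta_min (sqrt (INR D) / INR q) N <= C * Rpower (INR N) (-1 + eps).
Proof.
  intros HD Hq Hy Hpell Heps.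
  (* As 2h + 1 = [fermat_prod k] exceeds k, the loss 1 - th = 1/(2h+2) is below 1/k < eps. *)
  destruct (archimed_cor1 eps Heps) as [k [Hk Hk0]].
  pose proof (fermat_prod_ge k) as Hge.
  destruct (fermat_prod_odd k) as [h Hh].
  destruct (close_eigenvalues D q x y k h HD Hq Hy Hpell (eq_sym Hh))
    as [w [C [Hw [HC Hpairs]]]].
  set (alpha := sqrt (INR D) / INR q) in *.
  assert (Halpha : 0 < alpha).
  { apply Rdiv_lt_0_compat; [apply sqrt_lt_R0|]; apply lt_0_INR; lia. }
  (* The two summands control n and m: an eigenvalue below 9 (alpha + 1) T^2 has both n^2 and m^2
     below M T^2, hence n and m at most M T. *)
  destruct (INR_unbounded (9 * (alpha + 1) + 9 * (alpha + 1) / alpha)) as [M HM].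
  assert (Hk1 : 0 < 9 * (alpha + 1) / alpha) by (apply Rdiv_lt_0_compat; lra).
  assert (HM1 : (1 <= M)%nat).
  { apply INR_lt. cbn [INR]. lra. }
  assert (HM1r : 1 <= INR M) by (change 1 with (INR 1); apply le_INR, HM1).
  set (z := w ^ (2 * (h + 1))).
  assert (Hz : 1 < z) by (apply Rlt_pow_R1; [exact Hw|lia]).
  (* Chosen so that the grid size (M T)^2 is at most A z^l. *)
  set (A := (INR M * C) ^ 2).
  assert (HA : 0 < A) by (apply pow_lt, Rmult_lt_0_compat; lra).
  set (G := Rabs (lam alpha 2 - lam alpha 1)).
  assert (HG : 0 <= G) by apply Rabs_pos.
  set (th := INR (2 * h + 1) / INR (2 * (h + 1))).
  assert (Hth : 0 < th) by (apply Rdiv_lt_0_compat; apply lt_0_INR; lia).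
  assert (Hth1 : - th <= -1 + eps).
  { assert (INR (2 * (h + 1)) = INR (2 * h + 1) + 1)
      by (rewrite <- S_INR; f_equal; lia).
    assert (INR k <= INR (2 * h + 1)) by (apply le_INR; lia).
    assert (0 < INR k) by (apply lt_0_INR; lia).
    assert (/ INR (2 * (h + 1)) <= / INR k) by (apply Rinv_le_contravar; lra).
    assert (th = 1 - / INR (2 * (h + 1))) by (unfold th; rewrite H; field; lra).
    lra. }
  set (B := A * z ^ 2).
  assert (HB : 0 < B) by (apply Rmult_lt_0_compat; [exact HA|apply pow_lt; lra]).
  (* The first term serves N > A z, where N <= B z^l; the second serves the finitely many smaller N,
     where the first gap suffices. *)
  exists (8 * Rpower B th + G * (A * z)).
  assert (HBth : 0 < Rpower B th) by apply exp_pos.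
  assert (HGA : 0 <= G * (A * z)) by (repeat apply Rmult_le_pos; lra).
  split; [lra|].
  intros N HN.
  assert (HN1 : 1 <= INR N) by (change 1 with (INR 1); apply le_INR; lia).
  assert (HP : 0 < Rpower (INR N) (-1 + eps)) by apply exp_pos.
  destruct (Rlt_le_dec (A * z) (INR N)) as [Hbig|Hsmall].
  - destruct (odd_power_bracket z A (INR N) Hz HA Hbig) as [l [Hl [Hlo Hhi]]].
    destruct (Hpairs l Hl) as [T [u [v [Eu [Ev [Huv [Hdiff [Hv [HT1 HT]]]]]]]]].
    assert (HT1r : 1 <= INR T) by (change 1 with (INR 1); apply le_INR, HT1).
    assert (Hzl : z ^ l = (w ^ ((h + 1) * l)) ^ 2).
    { unfold z. rewrite <- !pow_mult. f_equal. ring. }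
    assert (Hgap : delta_min alpha N <= v - u).
    { apply delta_min_le with (M * T)%nat; auto.
      - assert (Hroot : forall n, INR n ^ 2 < INR M * INR T ^ 2 -> (n <= M * T)%nat).
        { intros n Hn. apply INR_le. rewrite mult_INR.
          assert (INR M * INR T ^ 2 <= (INR M * INR T) ^ 2).
          { replace ((INR M * INR T) ^ 2) with (INR M * (INR M * INR T ^ 2)) by ring.
            rewrite <- (Rmult_1_l (INR M * INR T ^ 2)) at 1.
            apply Rmult_le_compat_r; [|lra].
            apply Rmult_le_pos; [lra|apply pow2_ge_0]. }
          apply Rnot_lt_le. intro Hlt.
          assert ((INR M * INR T) ^ 2 <= INR n ^ 2)
            by (apply pow_incr; split; [apply Rmult_le_pos; lra|lra]).
          lra. }
        assert (HT2 : 0 < INR T ^ 2) by (apply pow_lt; lra).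
        intros m n _ _ Hmn.
        assert (Hm0 : 0 <= alpha * INR m ^ 2)
          by (apply Rmult_le_pos; [lra|apply pow2_ge_0]).
        pose proof (pow2_ge_0 (INR n)) as Hn0.
        split; apply Hroot.
        + apply Rmult_lt_reg_l with alpha; [exact Halpha|].
          apply Rle_lt_trans with (alpha * INR m ^ 2); [lra|].
          apply Rlt_le_trans with (9 * (alpha + 1) * INR T ^ 2); [lra|].
          replace (9 * (alpha + 1) * INR T ^ 2)
            with (alpha * (9 * (alpha + 1) / alpha * INR T ^ 2)) by (field; lra).
          apply Rmult_le_compat_l; [lra|]. apply Rmult_le_compat_r; lra.
        + apply Rlt_le_trans with (9 * (alpha + 1) * INR T ^ 2); [lra|].
          apply Rmult_le_compat_r; lra.
      - apply INR_lt. rewrite !mult_INR.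
        apply Rle_lt_trans with (A * z ^ l); [|exact Hlo].
        rewrite Hzl. unfold A.
        rewrite <- Rpow_mult_distr.
        replace (INR M * INR T * (INR M * INR T)) with ((INR M * INR T) ^ 2) by ring.
        apply pow_incr. split; [nra|].
        rewrite Rmult_assoc. apply Rmult_le_compat_l; lra. }
    apply Rle_trans with (1 := Hgap). rewrite Hdiff.
    assert (Hzpos : 0 < z ^ l) by (apply pow_lt; lra).
    (* The exponent th converts the count z^l into the reciprocal gap, up to the factor 8. *)
    assert (Hpow : w ^ ((2 * h + 1) * l) = Rpower (z ^ l) th).
    { unfold z. rewrite <- pow_mult, <- !Rpower_pow, Rpower_mult by lra.
      f_equal. unfold th. rewrite !mult_INR. field.
      repeat split; apply not_0_INR; lia. }
    assert (HBN : Rpower (INR N) th <= Rpower B th * w ^ ((2 * h + 1) * l)).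
    { rewrite Hpow, Rpower_mult_distr by assumption.
      apply Rle_Rpower_l; [lra|]. split; [lra|].
      rewrite pow_add in Hhi. unfold B. lra. }
    assert (HW : 0 < w ^ ((2 * h + 1) * l)) by (apply pow_lt; lra).
    apply Rle_trans with (8 * Rpower B th * Rpower (INR N) (- th)).
    + rewrite Rpower_Ropp.
      assert (HNth : 0 < Rpower (INR N) th) by apply exp_pos.
      apply Rmult_le_reg_r with (w ^ ((2 * h + 1) * l) * Rpower (INR N) th);
        [apply Rmult_lt_0_compat; assumption|].
      replace (8 / w ^ ((2 * h + 1) * l) * (w ^ ((2 * h + 1) * l) * Rpower (INR N) th))
        with (8 * Rpower (INR N) th) by (field; lra).
      replace (8 * Rpower B th * / Rpower (INR N) th
          * (w ^ ((2 * h + 1) * l) * Rpower (INR N) th))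
        with (8 * (Rpower B th * w ^ ((2 * h + 1) * l))) by (field; lra).
      lra.
    + assert (Rpower (INR N) (- th) <= Rpower (INR N) (-1 + eps))
        by (apply Rle_Rpower; assumption).
      apply Rle_trans with (8 * Rpower B th * Rpower (INR N) (-1 + eps)).
      * apply Rmult_le_compat_l; lra.
      * apply Rmult_le_compat_r; lra.
  - apply Rle_trans with G.
    + apply Rle_trans with (lam alpha 2 - lam alpha 1).
      * apply fold_Rmin_le_init.
      * apply Rle_abs.
    (* For N <= A z, the factor A z N^(-1+eps) is at least A z / N >= 1. *)
    + assert (Hinv : / INR N <= Rpower (INR N) (-1 + eps)).
      { apply Rle_trans with (Rpower (INR N) (- (1))).
        - rewrite Rpower_Ropp, Rpower_1 by lra. lra.
        - apply Rle_Rpower; lra. }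
      assert (1 <= A * z * Rpower (INR N) (-1 + eps)).
      { apply Rle_trans with (INR N * / INR N); [rewrite Rinv_r; lra|].
        apply Rmult_le_compat; try lra. left. apply Rinv_0_lt_compat. lra. }
      apply Rle_trans with (G * (A * z * Rpower (INR N) (-1 + eps))); nra.
Qed.

Theorem theorem1p1 :
  forall r : Q, (0 < r)%Q ->
  (~ exists q : Q, sqrt (Q2R r) = Q2R q) ->
  forall eps : R, 0 < eps ->
  exists C : R, 0 < C /\
    forall N : nat, (2 <= N)%nat ->
      delta_min (sqrt (Q2R r)) N <= C * Rpower (INR N) (-1 + eps).
Proof.
  intros [p q] Hr Hirr eps Heps.
  assert (Hp : (0 < p)%Z) by (unfold Qlt in Hr; cbn in Hr; lia).
  (* sqrt (p/q) = sqrt (p q) / q puts alpha in the form sqrt D / q. *)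
  set (d := (p * Z.pos q)%Z).
  assert (Hd : (0 < d)%Z) by (unfold d; lia).
  assert (Hq0 : 0 < IZR (Z.pos q)) by (apply IZR_lt; lia).
  assert (Hsqrt : sqrt (Q2R (p # q)) = sqrt (IZR d) / IZR (Z.pos q)).
  { unfold Q2R; cbn [Qnum Qden].
    replace (IZR p * / IZR (Z.pos q)) with (IZR d / (IZR (Z.pos q) * IZR (Z.pos q)))
      by (unfold d; rewrite mult_IZR; field; lra).
    rewrite sqrt_div_alt by nra. rewrite sqrt_square by lra. reflexivity. }
  destruct (pell_solution d Hd) as [x [y [Hy0 Hxy]]].
  { intros a b Hb E. apply Hirr.
    (* If a^2 = d b^2, then sqrt d = |a|/|b|, so alpha would be the rational |a| / (|b| q). *)
    exists (Z.abs a # (Z.to_pos (Z.abs b) * q)).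
    assert (HB : 0 < IZR (Z.abs b)) by (apply IZR_lt; lia).
    assert (Hs : sqrt (IZR d) = IZR (Z.abs a) / IZR (Z.abs b)).
    { apply sqrt_lem_1.
      - apply IZR_le. lia.
      - apply Rmult_le_pos; [apply IZR_le; lia|].
        left. apply Rinv_0_lt_compat, HB.
      - replace (IZR (Z.abs a) / IZR (Z.abs b) * (IZR (Z.abs a) / IZR (Z.abs b)))
          with (IZR (Z.abs a * Z.abs a) / IZR (Z.abs b * Z.abs b))
          by (rewrite !mult_IZR; field; lra).
        rewrite !Z.abs_square, E, !mult_IZR. field.
        apply not_0_IZR. exact Hb. }
    rewrite Hsqrt, Hs. unfold Q2R; cbn [Qnum Qden].
    rewrite Pos2Z.inj_mul, Z2Pos.id by lia. rewrite mult_IZR. field. lra. }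
  destruct (delta_min_bound (Z.to_nat d) (Pos.to_nat q) (Z.abs_nat x) (Z.abs_nat y) eps)
    as [C HC]; try lia; try assumption.
  exists C. rewrite Hsqrt.
  rewrite !INR_IZR_INZ, Z2Nat.id, positive_nat_Z in HC by lia. exact HC.
Qed.
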